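(* Let $X$ be a topological space. If $X\in\Delta$ and $\mathrm{cf}\big(o(X)\big)>\omega$, then $|X|<o(X)$.
   Context: A topological space $X$ is a $\Delta$-space (written $X\in\Delta$) if for every decreasing sequence $\{A_n : n<\omega\}$ of subsets of $X$ (i.e. $A_{n+1}\subset A_n$ for all $n$) with $\bigcap_{n<\omega}A_n=\emptyset$ there is a (decreasing) sequence $\{U_n : n<\omega\}$ of open subsets of $X$ with $\bigcap_{n<\omega}U_n=\emptyset$ and $A_n\subset U_n$ for all $n<\omega$. No separation axiom is assumed. $o(X)$ denotes the cardinality of the family of all open subsets of $X$ (equivalently, of all closed subsets of $X$), and $\mathrm{cf}$ denotes cofinality. *)

(* Defs.v *)
From mathcomp Require Import all_boot.
From mathcomp Require Import boolp classical_sets functions cardinality wochoice.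
From mathcomp Require Import topology.

Set Implicit Arguments.
Unset Strict Implicit.
Unset Printing Implicit Defensive.

Local Open Scope classical_set_scope.
Local Open Scope card_scope.

Definition card_lt (T U : Type) (A : set T) (B : set U) : Prop :=
  A #<= B /\ ~ (A #= B).

Notation "A '#<' B" := (card_lt A B) (at level 79) : card_scope.

Definition delta_space (X : topologicalType) : Prop :=
  forall A : nat -> set X,
    (forall n, A n.+1 `<=` A n) -> \bigcap_n A n = set0 ->
    exists U : nat -> set X,
      [/\ forall n, open (U n),
          forall n, U n.+1 `<=` U n,
          \bigcap_n U n = set0 &
          forall n, A n `<=` U n].

(* [r] has the order type of the initial ordinal of cardinality |T|.
   [well_order] makes [r] a reflexive (non-strict) total order. *)
Definition initial_well_order (T : Type) (r : rel T) : Prop :=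
  well_order r /\ forall x, [set y | r y x /\ y <> x] #< [set: T].

Definition cofinal (T : Type) (r : rel T) (C : set T) : Prop :=
  forall x, exists2 y, C y & r x y.

(* The cardinality of such a [C] is the cofinality of [r]. *)
Definition min_cofinal (T : Type) (r : rel T) (C : set T) : Prop :=
  cofinal r C /\ forall D : set T, cofinal r D -> C #<= D.

(* |B| < cf(|A|): the cardinal |A| is presented as an initial well-order on
   (the subtype of elements of) A. Such an order exists and is unique up to
   isomorphism, and so is |C|; hence the existential quantifiers lose nothing. *)
Definition card_lt_cof (U V : Type) (B : set V) (A : set U) : Prop :=
  exists r : rel (set_type A), initial_well_order r /\
    exists C : set (set_type A), min_cofinal r C /\ B #< C.

(* Main.v *)
Require Import Defs.
From mathcomp Require Import all_boot.
From mathcomp Require Import boolp classical_sets functions cardinality wochoice.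
From mathcomp Require Import topology.

Local Open Scope classical_set_scope.
Local Open Scope card_scope.

(** Write k for the number of open sets and suppose, for a contradiction, that
    k <= |X|; fix an injection of k into X. Two facts about the cardinal k
    clash with the Delta property.

    - [bernstein_coloring]: there are only k closed sets, so the transfinite
      construction of a Bernstein set yields a function f from k to nat that
      takes every value on the trace of every closed set whose trace on k has
      full cardinality k. One picks k * aleph_0 = k distinct points, one for
      each pair of a closed set and a value.
    - [countable_cover_full]: because cf(k) is uncountable, a cover of k by
      countably many sets has a member of cardinality k.

    Apply the Delta property to the sets A_n of the points (of the copy of k)
    where f >= n. It gives open sets U_n containing A_n, with empty
    intersection, so that the complements of the U_n cover k and one of them
    has a trace of size k. On that trace f takes the value n, although any
    point where f = n lies in A_n, hence in U_n: contradiction. So k <= |X|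
    fails, and |X| < k follows from the comparability of cardinals.

    Cardinals are handled through one recursion, [greedy_injection]: along a
    well-order one can choose distinct representatives of sets P x as long as
    no P x injects into the strict initial segment below x. It gives the
    comparability of cardinals, the Bernstein construction, and the comparison
    of a non-full set with an initial segment. *)

Set Implicit Arguments.
Unset Strict Implicit.
Unset Printing Implicit Defensive.

(** * Cardinal inequalities as injections *)

Lemma injfun_card_le (T U : Type) (A : set T) (B : set U) (f : T -> U) :
  (forall x, A x -> B (f x)) ->
  (forall x y, A x -> A y -> f x = f y -> x = y) -> A #<= B.
Proof.
move=> fAB finj.
have /injfunPex[g] : exists2 f : T -> U, set_fun A B f & set_inj A f.
  by exists f => // x y /set_mem Ax /set_mem Ay; apply: finj.
exact: inj_card_le g.
Qed.

(** The point [u] makes room for a total function, defined also off [A]. *)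
Lemma card_le_injfun (T U : Type) (A : set T) (B : set U) (u : U) : A #<= B ->
  exists f : T -> U, (forall x, A x -> B (f x)) /\
    (forall x y, A x -> A y -> f x = f y -> x = y).
Proof.
elim/Ppointed: U => U in B u *; first by case: (no u).
move=> /pcard_leP/injfunPex[f fAB finj]; exists f; split=> // x y Ax Ay.
by apply: finj; apply: mem_set.
Qed.

Lemma card_leT_inj (T U : Type) (B : set U) : [set: T] #<= B ->
  exists2 f : T -> U, injective f & forall x, B (f x).
Proof.
move=> /card_leP[f]; exists (fun x => val (f (to_setT x))) => [x y|x].
  by move=> /val_inj/('inj_f (mem_set I) (mem_set I))/(congr1 val).
exact: set_valP.
Qed.

(** * Infinite cardinals absorb multiplication by aleph_0 *)

(** Each block absorbs the factor [nat], and the blocks being disjoint, the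
    chosen injections of the blocks can be glued together. *)
Lemma card_bigcupX_nat (T : Type) (E : set (set T)) : trivIset E id ->
  (forall C, E C -> C `*` [set: nat] #<= C) ->
  (\bigcup_(C in E) C) `*` [set: nat] #<= \bigcup_(C in E) C.
Proof.
move=> tE hE; have [->|/set0P[t _]] := eqVneq (\bigcup_(C in E) C) set0.
  by rewrite set0X.
have /choice[g gP] : forall C : set T, exists g : T * nat -> T, E C ->
    (forall p, (C `*` [set: nat]) p -> C (g p)) /\
    (forall p q, (C `*` [set: nat]) p -> (C `*` [set: nat]) q ->
       g p = g q -> p = q).
  move=> C; have [EC|nEC] := pselect (E C); last by exists (fun=> t).
  by have [g gP] := card_le_injfun t (hE C EC); exists g.
have /choice[c cP] : forall x, exists C : set T,
    (\bigcup_(C in E) C) x -> E C /\ C x.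
  move=> x; have [[C EC Cx]|nx] := pselect ((\bigcup_(C in E) C) x).
    by exists C.
  by exists set0.
apply: (@injfun_card_le _ _ _ _ (fun p => g (c p.1) p)).
  by move=> [x n] [/= /cP[Ec cx] _]; exists (c x) => //; apply: (gP _ Ec).1.
move=> [x n] [y m] [/= /cP[Ecx cx] _] [/= /cP[Ecy cy] _] eqg.
have [gx ginj] := gP _ Ecx; have [gy _] := gP _ Ecy.
(* The common image lies in the blocks of both x and y. *)
have ecxy : c x = c y.
  apply: tE => //; exists (g (c x) (x, n)); split; first exact: gx.
  by rewrite /= eqg; apply: gy.
by apply: ginj; [split | split=> //=; rewrite ecxy | rewrite eqg ecxy].
Qed.

(** An infinite set splits into disjoint countably infinite blocks: a maximal
    disjoint family of such blocks misses only finitely many points, which can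
    be merged into one block. The claim then reduces to the countable case. *)
Lemma card_setX_nat (T : Type) (A : set T) :
  infinite_set A -> A `*` [set: nat] #<= A.
Proof.
move=> Ainf; pose D := [set C : set T | C `<=` A /\ C #= [set: nat]].
have sub_inf (R : set T) :
    R `<=` A -> infinite_set R -> exists2 C, D C & C `<=` R.
  move=> RA Rinf; have [t _] := infinite_setN0 Rinf.
  have [f [fR finj]] := card_le_injfun t ((infiniteP R).1 Rinf).
  have rR : range f `<=` R by move=> _ [n _ <-]; apply: fR.
  exists (range f) => //; split; first exact: subset_trans RA.
  by apply: inj_card_eq => x y _ _; apply: finj.
have [E [ED tE maxE]] := @ex_maximal_disjoint_subcollection _ _ (@id (set T)) D.
pose R := A `\` \bigcup_(C in E) C.
have Rfin : finite_set R.
  apply: contrapT => Rinf; have [C DC CR] := sub_inf R (@subDsetl _ _ _) Rinf.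
  have [x Cx] : C !=set0.
    by apply: infinite_setN0; apply/infiniteP; case: DC => _ /card_eqPle[].
  have nEC : ~ E C by move=> EC; have [_] := CR _ Cx; apply; exists C.
  apply: (maxE (C |` E)).
  - by split=> [|sE]; [exact: subsetUr | apply/nEC/sE; left].
  - by move=> F [->|/ED].
  - have disj F : E F -> ~ (C `&` F !=set0).
      by move=> EF [y [/CR[_ nEy] Fy]]; apply: nEy; exists F.
    move=> F G /= [->|EF] [->|EG] //; last exact: tE.
      by move/(disj _ EG).
    by rewrite setIC => /(disj _ EF).
have [F0 EF0] : E !=set0.
  apply/set0P/negP => /eqP E0; apply: Ainf; move: Rfin.
  by rewrite /R E0 bigcup_set0 setD0.
pose E' := (F0 `|` R) |` (E `\ F0).
have UE' : \bigcup_(C in E') C = A.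
  apply/seteqP; split=> [x [C [->|[EC _]] Cx]|x Ax].
  - by case: Cx => [F0x|[]//]; apply: (ED _ EF0).1.
  - exact: (ED _ EC).1.
  - have [[C EC Cx]|nx] := pselect ((\bigcup_(C in E) C) x).
      have [CF|CF] := pselect (C = F0); last by exists C => //; right.
      by exists (F0 `|` R); [left | left; rewrite -CF].
    by exists (F0 `|` R); [left | right].
rewrite -UE'; apply: card_bigcupX_nat.
  have disj F : (E `\ F0) F -> ~ ((F0 `|` R) `&` F !=set0).
    move=> [EF nF] [y [[F0y|[_ nEy]] Fy]]; last by apply: nEy; exists F.
    by apply: nF; apply: tE => //; exists y.
  move=> F G /= [->|EF] [->|EG] //; last by apply: tE; [case: EF | case: EG].
    by move/(disj _ EG).
  by rewrite setIC => /(disj _ EF).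
move=> C E'C; have [Ccnt Cinf] : countable C /\ [set: nat] #<= C.
  case: E'C => [->|[/ED[_ /card_eqPle[]]//]].
  have [_ /card_eqPle[F0c F0i]] := ED _ EF0; split.
    rewrite -bigcup2E; apply: bigcup_countable => // -[|[|i]] _ //=.
    exact: finite_set_countable.
  by apply: card_le_trans F0i _; apply: subset_card_le; exact: subsetUl.
apply: card_le_trans Cinf.
exact: countableX.
Qed.

(** * Well-orders and greedy choice *)

Definition strict_segment (T : Type) (r : rel T) (x : T) : set T :=
  [set y | r y x /\ y <> x].

Section WellOrder.
Context (T : Type) (r : rel T) (r_wo : well_order r).

Lemma well_order_min (P : set T) : P !=set0 ->
  exists2 z, P z & forall x, P x -> r z x.
Proof using r_wo.
move=> [x Px]; have [|z [[/set_mem Pz zmin] _]] := r_wo (A := mem P).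
  by exists x; apply: mem_set.
by exists z => // y Py; apply/zmin/mem_set.
Qed.

(** Two elements below each other are both minima of the pair they form, and
    the minimum is unique. *)
Lemma well_order_anti (x y : T) : r x y -> r y x -> x = y.
Proof using r_wo.
move=> rxy ryx.
have rr z : r z z by have [|w -> ->] := @well_order_min [set z]; first exists z.
have [|z [_ zuniq]] := r_wo (A := mem [set x; y]).
  by exists x; apply: mem_set; left.
suff zE w : (w = x \/ w = y) -> z = w by rewrite -(zE x) ?(zE y); auto.
move=> wxy; apply: zuniq; split; first exact: mem_set.
by case: wxy => -> v /set_mem[]->.
Qed.

Lemma well_order_trans (x y z : T) : r x y -> r y z -> r x z.
Proof using r_wo.
move=> rxy ryz; have [|w wxyz wmin] := @well_order_min [set x; y; z].
  by exists z; right.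
have [wx wy wz] : [/\ r w x, r w y & r w z].
  by split; apply: wmin; rewrite /=; auto.
case: wxyz => [[wE|wE]|wE]; first by rewrite -wE.
  by rewrite (well_order_anti rxy) // -wE.
by rewrite -(well_order_anti ryz) // -wE.
Qed.

Lemma well_order_lt (x y : T) : ~ r x y -> strict_segment r x y.
Proof using r_wo.
have [|z] := @well_order_min [set x; y]; first by exists x; left.
move=> /= zxy zmin nrxy.
have yx : r y x.
  case: zxy => zE; first by case: nrxy; rewrite -{1}zE; apply: zmin; right.
  by rewrite -zE; apply: zmin; left.
split=> // exy; apply: nrxy; rewrite -{1}exy.
case: zxy => zE; subst; apply: zmin; by [left|right].
Qed.

Lemma strict_segment_wf : well_founded (fun y x => strict_segment r x y).
Proof using r_wo.
move=> x; apply: contrapT => nx.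
have [|z nz zmin] :=
  @well_order_min [set z | ~ Acc (fun y x => strict_segment r x y) z].
  by exists x.
apply: nz; constructor=> y [ryz nyz]; apply: contrapT => ny.
by apply: nyz; apply: well_order_anti => //; apply: zmin.
Qed.

(** By recursion along [r]: the representatives already chosen for the elements
    below [x] cannot exhaust [P x], for otherwise [P x] would inject into the
    segment below [x]. *)
Lemma greedy_injection (U : Type) (P : T -> set U) :
  (forall x, ~ (P x #<= strict_segment r x)) ->
  exists2 h : T -> U, injective h & forall x, P x (h x).
Proof using r_wo.
move=> Pbig.
have fresh x (g : forall y, strict_segment r x y -> U) :
    exists u, P x u /\ forall y (xy : strict_segment r x y), g y xy <> u.
  apply: contrapT => nu; apply: (Pbig x).
  have /choice[k kP] : forall u : P x, exists y,
      exists xy : strict_segment r x y, g y xy = val u.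
    move=> u; apply: contrapT => nk; apply: nu; exists (val u).
    split; first exact: set_valP.
    by move=> y xy gy; apply: nk; exists y, xy.
  rewrite -(card_le_eql (card_setT (P x))).
  apply: (@injfun_card_le _ _ _ _ k) => [u _|u v _ _ kuv].
    by case: (kP u).
  apply: val_inj; case: (kP u) => xu <-; case: (kP v) => xv <-.
  by move: xu xv; rewrite kuv => xu xv; rewrite (Prop_irrelevance xu xv).
pose step x g := projT1 (cid (fresh x g)).
pose h := Fix strict_segment_wf (fun=> U) step.
have hE x : h x = step x (fun y _ => h y).
  apply: Fix_eq => {}x f g fg; congr (step x _).
  apply: functional_extensionality_dep => y.
  exact: functional_extensionality_dep.
have hP x : P x (h x) /\ forall y, strict_segment r x y -> h y <> h x.
  by rewrite (hE x) /step; case: cid.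
exists h => [x y hxy|x]; last exact: (hP x).1.
have [rxy|nrxy] := pselect (r x y); last first.
  by case: ((hP x).2 y (well_order_lt nrxy)).
apply: contrapT => nxy.
by case: ((hP y).2 x (conj rxy nxy)).
Qed.

End WellOrder.

(** Greedy choice along a well-order of [T] either embeds [T] into [U], or is
    stuck at a segment into which [U] embeds. *)
Lemma card_le_comparable (T U : choiceType) :
  ~ ([set: T] #<= [set: U]) -> [set: U] #<= [set: T].
Proof.
move=> nTU; have [r r_wo] := well_ordering_principle T.
apply: contrapT => nUT; apply: nTU.
have [x le_x|h hinj _] := greedy_injection r_wo (P := fun=> [set: U]).
  by apply: nUT; apply: card_le_trans le_x _; exact: card_leT.
by apply: (@injfun_card_le _ _ _ _ h) => // x y _ _; apply: hinj.
Qed.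

(** * Two properties of initial well-orders *)

(** Full-size sets have distinct representatives, since strict segments of an
    initial well-order are too small to contain a copy of [T]. *)
Lemma initial_greedy_injection (T U : Type) (r : rel T) (P : T -> set U) :
  initial_well_order r -> (forall x, [set: T] #<= P x) ->
  exists2 h : T -> U, injective h & forall x, P x (h x).
Proof.
move=> [r_wo r_init] Pbig; apply: (greedy_injection r_wo) => x le_x.
have [le_xT ne_xT] := r_init x; apply: ne_xT.
by apply: Cantor_Bernstein => //; apply: card_le_trans le_x.
Qed.

(** A Bernstein-type construction: encode the pairs (t, n) injectively in [T],
    choose distinct points of the full-size sets [S t], one for each pair, and
    color the point chosen for (t, n) by [n]. *)
Lemma bernstein_coloring (T : Type) (r : rel T) (S : T -> set T) :
  initial_well_order r -> infinite_set [set: T] ->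
  exists f : T -> nat, forall t n, [set: T] #<= S t ->
    exists2 x, S t x & f x = n.
Proof.
move=> r_init Tinf.
have [t0 _] := infinite_setN0 Tinf.
have [j [_ jinj]] := card_le_injfun t0 (card_setX_nat Tinf).
have {}jinj : injective j by move=> p q; apply: jinj.
(* P x is the whole type when x codes no pair, or codes one whose set is small:
   the greedy choice needs a full-size set at every index. *)
pose P x := [set y | forall p, j p = x -> [set: T] #<= S p.1 -> S p.1 y].
have [|h hinj hP] := initial_greedy_injection (P := P) r_init.
  move=> x; have [[p [jp Sp]]|np] :=
      pselect (exists p, j p = x /\ [set: T] #<= S p.1).
    apply: card_le_trans Sp _; apply: subset_card_le => y Sy q jq _.
    by rewrite (jinj q p) // jp.
  by apply: subset_card_le => y _ p jp Sp; case: np; exists p.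
have /choice[f fP] : forall y, exists n, forall p, h (j p) = y -> n = p.2.
  move=> y; have [[p hp]|np] := pselect (exists p, h (j p) = y).
    by exists p.2 => q; rewrite -hp => /hinj/jinj->.
  by exists 0 => p hp; case: np; exists p.
exists f => t n St; exists (h (j (t, n))); first exact: (hP (j (t, n)) (t, n)).
exact: (fP _ (t, n)).
Qed.

Lemma cofinality_uncountable (T : Type) (r : rel T) (C : set T) :
  min_cofinal r C -> [set: nat] #< C ->
  ~ countable [set: T] /\ forall x : nat -> T, ~ cofinal r (range x).
Proof.
move=> [_ Cmin] [natC nnatC].
have C_uncountable : ~ (C #<= [set: nat]).
  by move=> ?; apply/nnatC/Cantor_Bernstein.
split=> [Tc|x xcof]; apply: C_uncountable.
  by apply: card_le_trans Tc; apply: card_leT.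
exact: card_le_trans (Cmin _ xcof) (card_image_le _ _).
Qed.

(** If no [B n] has full size, each embeds into the segment below some [x n].
    The [x n] are not cofinal, so one segment, below [z] say, receives all the
    [B n], whence |T| <= |segment| * aleph_0. That product is at most aleph_0
    or |segment|, and both are smaller than |T|. *)
Lemma countable_cover_full (T : Type) (r : rel T) (C : set T)
    (B : nat -> set T) :
  initial_well_order r -> min_cofinal r C -> [set: nat] #< C ->
  \bigcup_n B n = [set: T] -> exists n, [set: T] #<= B n.
Proof.
move=> [r_wo r_seg] Cmin natC Bcover.
have [Tunc ncof] := cofinality_uncountable Cmin natC.
apply: contrapT => nB.
have /choice[x xP] : forall n, exists x, B n #<= strict_segment r x.
  move=> n; apply: contrapT => nx; apply: nB; exists n.
  have [|h hinj hB] := greedy_injection r_wo (P := fun=> B n).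
    by move=> x le_x; apply: nx; exists x.
  by apply: (@injfun_card_le _ _ _ _ h) => // y z _ _; apply: hinj.
have [z zP] : exists z, forall n, ~ r z (x n).
  apply: contrapT => nz; apply: (ncof x) => z; apply: contrapT => nrz.
  by apply: nz; exists z => n rzx; apply: nrz; exists (x n) => //; exists n.
have Bz n : B n #<= strict_segment r z.
  apply: card_le_trans (xP n) _; apply: subset_card_le => y [ryx nyx].
  apply: (well_order_lt r_wo) => rzy; apply: (zP n).
  exact: well_order_trans rzy ryx.
have /choice[g gP] := fun n => card_le_injfun z (Bz n).
have /choice[m mP] : forall t, exists n, B n t.
  by move=> t; have [n _ Bt] : (\bigcup_n B n) t; [rewrite Bcover | exists n].
have T_le : [set: T] #<= strict_segment r z `*` [set: nat].
  apply: (@injfun_card_le _ _ _ _ (fun t => (g (m t) t, m t))).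
    by move=> t _; split=> //; apply: (gP (m t)).1.
  move=> s t _ _ [gst mst]; apply: (gP (m s)).2 => //.
    by rewrite mst.
  by rewrite gst mst.
have seg_inf : infinite_set (strict_segment r z).
  move=> /finite_set_countable segc; apply: Tunc.
  by apply: (card_le_trans T_le); apply: countableX.
have [seg_le ne_seg] := r_seg z; apply: ne_seg; apply: Cantor_Bernstein => //.
exact: card_le_trans T_le (card_setX_nat seg_inf).
Qed.

(** * Delta-spaces have fewer points than open sets *)

Unset Implicit Arguments.

Theorem corollary4p2 (X : topologicalType) (hDelta : delta_space X)
  (hcf : card_lt_cof [set: nat] (@open X)) : [set: X] #< @open X.
Proof.
case: hcf => r [r_init [C [Cmin natC]]].
have [Tunc _] := cofinality_uncountable Cmin natC.
suff nle : ~ ([set: @open X] #<= [set: X]).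
  have leX := card_le_comparable nle; split.
    by rewrite -(card_le_eqr (card_setT (@open X))).
  move=> /card_eqPle[_ leo]; apply: nle.
  by rewrite (card_le_eql (card_setT (@open X))).
move=> /card_leT_inj[i i_inj _].
(* S t is the trace, on the copy of o(X) in X, of the closed complement of t. *)
pose S (t : @open X) := [set s : @open X | ~ val t (i s)].
have Tinf : infinite_set [set: @open X] by move=> /finite_set_countable.
have [f fP] := bernstein_coloring S r_init Tinf.
pose A n := [set x | exists2 t, i t = x & (n <= f t)%N].
have [||U [U_open _ U0 AU]] := hDelta A.
- by move=> n x [t <- /ltnW ft]; exists t.
- apply/seteqP; split=> // x Ax; have [t ix _] := Ax 0 I.
  have [s] := Ax (f t).+1 I; rewrite -ix => /i_inj->.
  by rewrite ltnn.
pose u n : @open X := SigSub (mem_set (U_open n)).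
have [|n Sn] := countable_cover_full (B := S \o u) r_init Cmin natC.
  apply/seteqP; split=> // t _; apply: contrapT => nS.
  suff : (\bigcap_n U n) (i t) by rewrite U0.
  by move=> n _; apply: contrapT => nU; apply: nS; exists n.
have [t nUt ft] := fP (u n) n Sn.
by apply: nUt; apply: AU; exists t => //; rewrite ft.
Qed.
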